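(* Let $k\ge2$ and $1\le t<2^k-1$, let $W$ be the $k$-bit cyclic word of $t$, and let $R$ and $Z$ be its numbers of ones and zeros. Assume $R<Z$. Let $z_1,\ldots,z_R$ be the cyclic numbers of zeros between successive ones of $W$, and let $s=|\{i:z_i>0\}|$, which is the number of cyclic runs of $1$'s in $W$. Then the following statements hold. (i) There is a positive integer $M_-(W)$ such that $$2^{k-1}-|S_{t,k}|=2^{Z-R}M_-(W)-1,$$ where explicitly $$M_-(W)=h_{R-1,R}(W)+2\sum_{\ell=1}^{R-1}4^{R-\ell-1}\Delta_\ell(W).$$ In particular, $|S_{t,k}|\equiv 1\pmod{2^{Z-R}}$. (ii) The quantity $\Delta_R(W)$ satisfies $$\Delta_R(W)=2\,[y^R]\prod_{i=1}^{R}(1+y+\cdots+y^{z_i}).$$ (iii) One has $$2^{k-1}-|S_{t,k}|\ge 2^{Z-R}\sum_{r=0}^{\min\{Z-R,\,s-1\}}\binom{s-1}{r}-1.$$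
   Context: For an integer $n\ge0$, $\operatorname{wt}(n)$ is the number of ones in its binary expansion. For $k\ge2$, $N=2^k-1$ and $1\le t\le N-1$, $$S_{t,k}=\{(a,b)\in\{0,\ldots,N-1\}^2: a+b\equiv t \pmod N,\ \operatorname{wt}(a)+\operatorname{wt}(b)<k\}.$$ The $k$-bit word of $t=\sum_{i=0}^{k-1}\varepsilon_i2^i$ ($\varepsilon_i\in\{0,1\}$) is $W=\varepsilon_0\varepsilon_1\cdots\varepsilon_{k-1}$ (least significant bit first), regarded as a cyclic word. The numbers $z_1,\dots,z_R$ are the numbers of zeros lying strictly between cyclically consecutive ones (possibly $0$), so $z_1+\cdots+z_R=Z$; if $R=1$ then $z_1=Z$. Put $$C_0(u,v)=\begin{pmatrix} 1 & 0 \\ u & v \end{pmatrix},\qquad C_1(u,v)=\begin{pmatrix} u & v \\ 0 & 1 \end{pmatrix},\qquad M_W(u,v)=C_{\varepsilon_0}(u,v)\cdots C_{\varepsilon_{k-1}}(u,v).$$ The polynomial $H_W(u,v)=\sum_{p,q\ge0}h_{p,q}(W)u^pv^q\in\mathbb Z[u,v]$ is defined by $$\operatorname{tr}M_W(u,v)-u^Rv^Z=1+(u+v-1)H_W(u,v)$$ (the required divisibility by $u+v-1$ always holds); it depends only on the cyclic word $W$. For $\ell\ge1$, $\Delta_\ell(W)=2h_{\ell-1,\ell}(W)-h_{\ell,\ell}(W)$. The notation $[y^q]P(y)$ means the coefficient of $y^q$ in $P(y)$. *)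

(* Defs.v *)
From HB Require Import structures.
From mathcomp Require Import all_boot all_order all_algebra.
From mathcomp Require Import zify ring.

Set Implicit Arguments.
Unset Strict Implicit.
Unset Printing Implicit Defensive.

Import Order.TTheory GRing.Theory Num.Theory.

Local Open Scope ring_scope.

Definition bit (n i : nat) : bool := odd (n %/ 2 ^ i).

(* Bits of index at least [n] vanish because [n < 2 ^ n]. *)
Definition wt (n : nat) : nat := (\sum_(i < n) bit n i)%N.

Definition Sset (t k : nat) : {set 'I_(2 ^ k - 1) * 'I_(2 ^ k - 1)} :=
  [set ab : 'I_(2 ^ k - 1) * 'I_(2 ^ k - 1) |
    (ab.1 + ab.2 == t %[mod 2 ^ k - 1])%N && (wt ab.1 + wt ab.2 < k)%N].

(* Least significant bit first. *)
Definition bitword (k t : nat) : seq bool := mkseq (bit t) k.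

Definition nb_ones (w : seq bool) : nat := count id w.
Definition nb_zeros (w : seq bool) : nat := count negb w.

(* For a one at position [i], [behead (rot i w)] lists the letters that follow
   it cyclically, and [find id] counts the zeros before the next one; if there
   is no other one, it returns the length of the list, i.e. all the zeros. *)
Definition zero_gaps (w : seq bool) : seq nat :=
  [seq find id (behead (rot i w)) | i <- iota 0 (size w) & nth false w i].

Definition nb_pos_gaps (w : seq bool) : nat :=
  count (fun z => 0 < z)%N (zero_gaps w).

(* Each cyclic run of ones is counted at its last letter. *)
Lemma nb_pos_gaps_runs (w : seq bool) :
  false \in w ->
  nb_pos_gaps w =
  count (fun i => nth false w i && ~~ nth false w (i.+1 %% size w))
    (iota 0 (size w)).
Proof.
move=> w0; rewrite /nb_pos_gaps /zero_gaps count_map count_filter.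
apply: eq_in_count => i; rewrite mem_iota add0n /= => ltiw.
rewrite andbC; case wi: (nth false w i) => //=.
have w1 : true \in w by rewrite -wi mem_nth.
have gt1 : (1 < size w)%N.
  by case: (w) w0 w1 => [|a [|b s]] //; rewrite !inE => /eqP<-.
have nth_rot1 : nth false (behead (rot i w)) 0 = nth false w (i.+1 %% size w).
  rewrite nth_behead /rot nth_cat size_drop nth_drop addn1.
  have [lti1|] := ltnP 1 (size w - i)%N; first by rewrite modn_small //; lia.
  move=> le1; have -> : i.+1 = size w by lia.
  rewrite modnn nth_take; last by lia.
  by congr nth; lia.
rewrite -nth_rot1.
have : (0 < size (behead (rot i w)))%N by rewrite size_behead size_rot; lia.
by case: (behead _) => [|[] s].
Qed.

(* Z[u, v] is [{poly {poly int}}], with [u] the outer variable. *)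
Notation polyuv := {poly {poly int}}.
Definition uvar : polyuv := 'X.
Definition vvar : polyuv := 'X%:P.
Definition coefuv (P : polyuv) (p q : nat) : int := P`_p`_q.

Definition mx2 (A : nzRingType) (a b c d : A) : 'M[A]_2 :=
  \matrix_(i, j) if i == 0 then if j == 0 then a else b
                 else if j == 0 then c else d.

Definition Cmx (b : bool) : 'M[polyuv]_2 :=
  if b then mx2 uvar vvar 0 1 else mx2 1 0 uvar vvar.

Definition Mmx (w : seq bool) : 'M[polyuv]_2 := \prod_(b <- w) Cmx b.

(* The divisor is monic in [u]; [Hpoly_spec] shows that the division is exact,
   and [Hpoly_unique] that the quotient is unique. *)
Definition Hpoly (w : seq bool) : polyuv :=
  (\tr (Mmx w) - uvar ^+ nb_ones w * vvar ^+ nb_zeros w - 1)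
    %/ (uvar + vvar - 1).

Lemma uv1_monic : uvar + vvar - 1 \is monic.
Proof.
rewrite -addrA -[vvar - 1]opprK opprB /uvar /vvar -polyC1 -polyCB.
exact: monicXsubC.
Qed.

Lemma Mmx_row_sum (w : seq bool) :
  exists x y : polyuv,
    Mmx w 0 0 + Mmx w 0 1 = 1 + x * (uvar + vvar - 1) /\
    Mmx w 1 0 + Mmx w 1 1 = 1 + y * (uvar + vvar - 1).
Proof.
elim: w => [|b w [x [y [Ex Ey]]]].
  by exists 0, 0; rewrite /Mmx big_nil !mxE /= !mul0r !addr0 add0r.
rewrite /Mmx big_cons -/(Mmx w) !mxE !big_ord_recl !big_ord0 !addr0.
have -> : lift ord0 ord0 = 1 :> 'I_2 by apply/val_inj.
have -> : ord0 = 0 :> 'I_2 by apply/val_inj.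
have {}Ex : Mmx w 0 0 = 1 + x * (uvar + vvar - 1) - Mmx w 0 1.
  by rewrite -Ex addrK.
have {}Ey : Mmx w 1 0 = 1 + y * (uvar + vvar - 1) - Mmx w 1 1.
  by rewrite -Ey addrK.
rewrite Ex Ey /Cmx; case: b; rewrite !mxE /=.
  by exists (1 + uvar * x + vvar * y), y; split; ring.
by exists x, (1 + uvar * x + vvar * y); split; ring.
Qed.

Lemma det_mx2E (A : comNzRingType) (B : 'M[A]_2) :
  \det B = B 0 0 * B 1 1 - B 0 1 * B 1 0.
Proof.
rewrite (expand_det_row B 0) !big_ord_recl big_ord0 addr0.
rewrite /cofactor !det_mx11 !mxE /= expr0 expr1 mul1r mulN1r mulrN.
by congr (_ * B _ _ - B _ _ * B _ _); apply/val_inj.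
Qed.

Lemma det_Mmx (w : seq bool) :
  \det (Mmx w) = uvar ^+ nb_ones w * vvar ^+ nb_zeros w.
Proof.
rewrite /nb_ones /nb_zeros; elim: w => [|b w IHw].
  by rewrite /Mmx big_nil det1 mulr1.
rewrite /Mmx big_cons -/(Mmx w) det_mulmx IHw det_mx2E /Cmx.
by case: b; rewrite !mxE /= ?exprS; ring.
Qed.

Lemma Hpoly_spec (w : seq bool) :
  \tr (Mmx w) - uvar ^+ nb_ones w * vvar ^+ nb_zeros w =
  1 + (uvar + vvar - 1) * Hpoly w.
Proof.
rewrite /Hpoly; set d := uvar + vvar - 1; set n := _ - _.
suff [q Eq] : exists q, n - 1 = q * d.
  rewrite {1}Eq Pdiv.IdomainMonic.mulpK ?uv1_monic // mulrC -Eq.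
  by rewrite addrC subrK.
have [x [y []]] := Mmx_row_sum w; rewrite -/d => Ex Ey.
rewrite /n -det_Mmx det_mx2E /mxtrace !big_ord_recl big_ord0 addr0.
have -> : lift ord0 ord0 = 1 :> 'I_2 by apply/val_inj.
have -> : ord0 = 0 :> 'I_2 by apply/val_inj.
have {}Ex : Mmx w 0 1 = 1 + x * d - Mmx w 0 0 by rewrite -Ex addrC addKr.
have {}Ey : Mmx w 1 0 = 1 + y * d - Mmx w 1 1 by rewrite -Ey addrK.
exists (x * (1 - Mmx w 1 1) + y * (1 - Mmx w 0 0) + x * y * d).
by rewrite Ex Ey; ring.
Qed.

Lemma Hpoly_unique (w : seq bool) (H : polyuv) :
  \tr (Mmx w) - uvar ^+ nb_ones w * vvar ^+ nb_zeros w =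
    1 + (uvar + vvar - 1) * H ->
  H = Hpoly w.
Proof.
rewrite Hpoly_spec => /addrI /mulfI <- //.
exact: monic_neq0 uv1_monic.
Qed.

Definition h (w : seq bool) (p q : nat) : int := coefuv (Hpoly w) p q.

Definition Delta (w : seq bool) (l : nat) : int :=
  2 * h w l.-1 l - h w l l.

Definition Mminus (w : seq bool) : int :=
  let R := nb_ones w in
  h w R.-1 R + 2 * \sum_(1 <= l < R) 4 ^+ (R - l - 1) * Delta w l.

(* Main.v *)
From HB Require Import structures.
Require Import Defs.
From mathcomp Require Import all_boot all_order all_algebra.
From mathcomp Require Import zify ring.

(* Write [d = u + v - 1].  Reading the binary addition of [t] and a uniform [a]
   as a two-state carry process, [#|S|] is [2^k] times the value at
   [u = 1/(2x)], [v = x/2] of the positive-power part of [tr M_W]; as [d]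
   becomes a second difference in [x] there, the sum over positive powers
   telescopes and only the coefficients [h_(l,l)] and [h_(l-1,l)] survive,
   which gives [2^(k-1) - #|S| = 2^(k-1) sum_l 4^-l Delta_l - 1].  The top
   coefficient of [tr M_W] in [u] comes from the paths on which no one of [W]
   has an incoming carry, whence (ii) and, once [Delta_l >= 0] is known, the
   bound (iii).

   The latter is an inequality of LYM type, [(p+1) h_(p+1,q) <=
   (p+q+1) h_(p,q)].  It follows from applying the derivation
   [X = (1-u) d/du - v d/dv] to [tr M_W - u^R v^Z = 1 + d H_W]: [X] moves every
   factor [C_b(u,v)] of [M_W] towards [C_b(1,0)], which is the identity for
   [b = 1] and a rank one matrix for [b = 0].  After division by [d] this expresses
   [H - X H] as a sum over the letters of [W] of differences [H_W - H_(W\j)]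
   (for a one [j]) or [H_W - x_(W\j)] (for a zero [j]), where [x_w] counts the
   words [g] such that [1 g] is a subsequence of [w].  All these differences
   have nonnegative coefficients. *)

Import Order.TTheory GRing.Theory Num.Theory.
Local Open Scope ring_scope.

Set Implicit Arguments.
Unset Strict Implicit.
Unset Printing Implicit Defensive.

(** * Carry matrices and subsequence counts *)

Local Notation u := uvar.
Local Notation v := vvar.
Local Notation d := (uvar + vvar - 1).

Lemma mx2_mulE (A : nzRingType) (B C : 'M[A]_2) i j :
  (B * C) i j = B i 0 * C 0 j + B i 1 * C 1 j.
Proof.
rewrite mxE !big_ord_recl big_ord0 addr0.
by congr (_ * _ + B i _ * C _ j); apply/val_inj.
Qed.

Lemma mxtrace2 (A : nzRingType) (B : 'M[A]_2) : \tr B = B 0 0 + B 1 1.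
Proof.
rewrite /mxtrace !big_ord_recl big_ord0 addr0.
by congr (_ + B _ _); apply/val_inj.
Qed.

Lemma Mmx_cons (b : bool) (w : seq bool) : Mmx (b :: w) = Cmx b * Mmx w.
Proof. by rewrite /Mmx big_cons. Qed.

Lemma Mmx_cat (w1 w2 : seq bool) : Mmx (w1 ++ w2) = Mmx w1 * Mmx w2.
Proof. by rewrite /Mmx big_cat. Qed.

Lemma Mmx_cons0 (b : bool) (w : seq bool) j :
  Mmx (b :: w) 0 j =
  if b then u * Mmx w 0 j + v * Mmx w 1 j else Mmx w 0 j.
Proof. by rewrite Mmx_cons mx2_mulE; case: b; rewrite !mxE /=; ring. Qed.

Lemma Mmx_cons1 (b : bool) (w : seq bool) j :
  Mmx (b :: w) 1 j =
  if b then Mmx w 1 j else u * Mmx w 0 j + v * Mmx w 1 j.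
Proof. by rewrite Mmx_cons mx2_mulE; case: b; rewrite !mxE /=; ring. Qed.

Lemma Mmx_nil i j : Mmx [::] i j = (i == j)%:R.
Proof. by rewrite /Mmx big_nil mxE. Qed.

(* Generating function, by numbers of ones and of zeros, of the words [g] such
   that [c :: g] is a subsequence of [w]. *)
Fixpoint emb (c : bool) (w : seq bool) : polyuv :=
  if w is b :: w' then
    if b == c then 1 + u * emb true w' + v * emb false w' else emb c w'
  else 0.

(** Modulo [d] the rows of every [Cmx b] sum to 1, hence so do those of [Mmx w]; the quotient by [d]
    obeys the recursion of [emb]. The identity is solved for the off-diagonal entry so as to
    eliminate it by rewriting. *)
Lemma Mmx_row0 (w : seq bool) : Mmx w 0 1 = 1 + emb true w * d - Mmx w 0 0.
Proof.
apply/eqP; rewrite eq_sym subr_eq; apply/eqP.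
suff [-> //] : 1 + emb true w * d = Mmx w 0 1 + Mmx w 0 0 /\
               1 + emb false w * d = Mmx w 1 1 + Mmx w 1 0.
elim: w => [|b w [IH0 IH1]]; first by rewrite !Mmx_nil /=; split; ring.
rewrite !Mmx_cons0 !Mmx_cons1; case: b => /=; split=> //.
  transitivity (u * (1 + emb true w * d) + v * (1 + emb false w * d)).
    by ring.
  by rewrite IH0 IH1; ring.
transitivity (u * (1 + emb true w * d) + v * (1 + emb false w * d)); first ring.
by rewrite IH0 IH1; ring.
Qed.

Lemma Mmx_row1 (w : seq bool) : Mmx w 1 0 = 1 + emb false w * d - Mmx w 1 1.
Proof.
elim: w => [|b w IH]; first by rewrite !Mmx_nil /=; ring.
rewrite !Mmx_cons1; case: b => //=; rewrite IH Mmx_row0; ring.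
Qed.

Lemma trace_rot (n : nat) (w : seq bool) : \tr (Mmx (rot n w)) = \tr (Mmx w).
Proof.
rewrite -[in RHS](cat_take_drop n w) /rot !Mmx_cat.
exact: mxtrace_mulC.
Qed.

Lemma count_rot (p : pred bool) (n : nat) (w : seq bool) :
  count p (rot n w) = count p w.
Proof. by rewrite -[in RHS](cat_take_drop n w) /rot !count_cat addnC. Qed.

Lemma Hpoly_rot (n : nat) (w : seq bool) : Hpoly (rot n w) = Hpoly w.
Proof. by rewrite /Hpoly trace_rot /nb_ones /nb_zeros !count_rot. Qed.

(** Since [u^R v^Z] is the determinant of [Mmx w], it suffices to eliminate the off-diagonal entries
    from trace minus determinant by the row-sum identities. *)
Lemma HpolyE (w : seq bool) :
  Hpoly w = emb true w * (1 - Mmx w 1 1) + emb false w * (1 - Mmx w 0 0)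
            + emb true w * emb false w * d.
Proof.
symmetry; apply: Hpoly_unique.
rewrite -det_Mmx det_mx2E mxtrace2 Mmx_row0 Mmx_row1; ring.
Qed.

(** * Coefficientwise nonnegativity *)

Definition nneg_coef (P : {poly int}) : Prop := forall i, 0 <= P`_i.

Lemma nneg_coef0 : nneg_coef 0.
Proof. by move=> i; rewrite coef0. Qed.

Lemma nneg_coef1 : nneg_coef 1.
Proof. by move=> i; rewrite coef1; case: (i == 0)%N. Qed.

Lemma nneg_coefD (P Q : {poly int}) :
  nneg_coef P -> nneg_coef Q -> nneg_coef (P + Q).
Proof. by move=> nP nQ i; rewrite coefD addr_ge0. Qed.

Lemma nneg_coefM (P Q : {poly int}) :
  nneg_coef P -> nneg_coef Q -> nneg_coef (P * Q).
Proof.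
by move=> nP nQ i; rewrite coefM; apply: sumr_ge0 => j _; rewrite mulr_ge0.
Qed.

Lemma nneg_coefX : nneg_coef 'X.
Proof. by move=> i; rewrite coefX; case: (i == 1)%N. Qed.

Definition nneg_coefuv (P : polyuv) : Prop := forall p, nneg_coef P`_p.

Lemma nneg_coefuv0 : nneg_coefuv 0.
Proof. by move=> p; rewrite coef0; apply: nneg_coef0. Qed.

Lemma nneg_coefuv1 : nneg_coefuv 1.
Proof.
move=> p; rewrite coef1.
by case: (p == 0)%N; [apply: nneg_coef1|apply: nneg_coef0].
Qed.

Lemma nneg_coefuvD (P Q : polyuv) :
  nneg_coefuv P -> nneg_coefuv Q -> nneg_coefuv (P + Q).
Proof. by move=> nP nQ p; rewrite coefD; apply: nneg_coefD. Qed.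

Lemma nneg_coefuvM (P Q : polyuv) :
  nneg_coefuv P -> nneg_coefuv Q -> nneg_coefuv (P * Q).
Proof.
move=> nP nQ p; rewrite coefM; apply: (big_ind nneg_coef).
- exact: nneg_coef0.
- exact: nneg_coefD.
- by move=> j _; apply: nneg_coefM.
Qed.

Lemma nneg_uvar : nneg_coefuv u.
Proof.
move=> p; rewrite coefX.
by case: (p == 1)%N; [apply: nneg_coef1|apply: nneg_coef0].
Qed.

Lemma nneg_vvar : nneg_coefuv v.
Proof.
move=> p; rewrite coefC.
by case: (p == 0)%N; [apply: nneg_coefX|apply: nneg_coef0].
Qed.

Lemma nneg_Mmx (w : seq bool) i j : nneg_coefuv (Mmx w i j).
Proof.
have ord2P (k : 'I_2) : {k = 0} + {k = 1}.
  by case: k => [[|[|//]]] lt2; [left|right]; apply/val_inj.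
have E (P Q : polyuv) : nneg_coefuv P -> nneg_coefuv Q ->
    nneg_coefuv (u * P + v * Q).
  move=> nP nQ; apply: nneg_coefuvD; apply: nneg_coefuvM => //.
    exact: nneg_uvar.
  exact: nneg_vvar.
elim: w i => [|b w IH] i.
  rewrite Mmx_nil; case: (i == j); [exact: nneg_coefuv1|exact: nneg_coefuv0].
by have [->|->] := ord2P i; rewrite ?Mmx_cons0 ?Mmx_cons1; case: b => //;
  apply: E.
Qed.

(** The closed form [T w] of the difference has a negative term, but it starts at 0, a prefixed one
    multiplies it by [u], and a prefixed zero turns it into [Mmx w 0 1 + v * T w]. *)
Lemma Hpoly_cons0_ge_emb (w : seq bool) :
  nneg_coefuv (Hpoly (false :: w) - emb true w).
Proof.
pose T w := Mmx w 0 1 * (1 + v * emb false w) - v * emb true w * Mmx w 1 1.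
have -> : Hpoly (false :: w) - emb true w = T w.
  rewrite HpolyE Mmx_cons0 Mmx_cons1 /= /T Mmx_row0; ring.
elim: w => [|b w IH].
  by rewrite /T !Mmx_nil /= !(mulr0, mul0r) subr0; apply: nneg_coefuv0.
have -> : T (b :: w) = if b then u * T w else Mmx w 0 1 + v * T w.
  by rewrite /T !Mmx_cons0 !Mmx_cons1; case: b => /=; ring.
have [Du Dv] := (nneg_uvar, nneg_vvar).
case: b; first exact: nneg_coefuvM.
by apply: nneg_coefuvD; [exact: nneg_Mmx|exact: nneg_coefuvM].
Qed.

(** Same device: a prefixed one multiplies [T w] by [u], a prefixed zero gives
    [Mmx w 0 0 + v * T w]. *)
Lemma Hpoly_cons1_ge (w : seq bool) :
  nneg_coefuv (Hpoly (true :: w) - Hpoly w).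
Proof.
pose T w := Mmx w 1 0 * (1 - (1 - u) * emb true w)
            + (1 - u) * emb false w * Mmx w 0 0.
have -> : Hpoly (true :: w) - Hpoly w = T w.
  rewrite !HpolyE Mmx_cons0 Mmx_cons1 /= /T Mmx_row1; ring.
elim: w => [|b w IH].
  by rewrite /T !Mmx_nil /= !(mulr0, mul0r) addr0; apply: nneg_coefuv0.
have -> : T (b :: w) = if b then u * T w else Mmx w 0 0 + v * T w.
  by rewrite /T !Mmx_cons0 !Mmx_cons1; case: b => /=; ring.
have [Du Dv] := (nneg_uvar, nneg_vvar).
case: b; first exact: nneg_coefuvM.
by apply: nneg_coefuvD; [exact: nneg_Mmx|exact: nneg_coefuvM].
Qed.

(** * A derivation *)

(* The derivation [(1 - u) d/du - v d/dv], locked because unification otherwise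
   unfolds it when comparing polynomials. *)
HB.lock Definition deruv (P : polyuv) : polyuv :=
  P^`() - ('X * P^`() + map_poly (fun c : {poly int} => 'X * c^`()) P).

(** Source of the weights in [h_local_LYM]. *)
Lemma coef_deruv (P : polyuv) p q :
  coefuv (deruv P) p q =
  coefuv P p.+1 q *+ p.+1 - coefuv P p q *+ (p + q).
Proof.
have E0 : 'X * (0 : {poly int})^`() = 0 by rewrite deriv0 mulr0.
rewrite /coefuv deruv.unlock 2!coefB coefD coefD coef_map_id0 //.
rewrite !coef_deriv coefMn mulrnDr; congr (_ - (_ + _)).
  rewrite coefXM; case: p => [|p]; rewrite ?coef0 ?mulr0n //=.
  by rewrite coef_deriv coefMn.
by rewrite coefXM; case: q => [|q] /=; rewrite ?mulr0n // coef_deriv.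
Qed.

Lemma deruvD (P Q : polyuv) : deruv (P + Q) = deruv P + deruv Q.
Proof.
apply/polyP => p; apply/polyP => q; rewrite 2![in RHS]coefD.
have := coef_deruv; rewrite /coefuv => E; rewrite !E !coefD.
by rewrite !mulrnDl opprD addrACA.
Qed.

Lemma deruvM (P Q : polyuv) : deruv (P * Q) = deruv P * Q + P * deruv Q.
Proof.
pose D (c : {poly int}) := 'X * c^`().
have D0 : D 0 = 0 by rewrite /D deriv0 mulr0.
have DD a b : D (a + b) = D a + D b by rewrite /D derivD mulrDr.
have DM a b : D (a * b) = D a * b + a * D b by rewrite /D derivM; ring.
have E : map_poly D (P * Q) = map_poly D P * Q + P * map_poly D Q.
  apply/polyP => i; rewrite coef_map_id0 // coefD !coefM.
  rewrite (big_morph D DD D0) -big_split /=.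
  by apply: eq_bigr => j _; rewrite DM !coef_map_id0.
by rewrite deruv.unlock E derivM; ring.
Qed.

Lemma deruv0 : deruv 0 = 0.
Proof. by rewrite -[LHS](addrK (deruv 0)) -deruvD addr0 subrr. Qed.

Lemma deruv1 : deruv 1 = 0.
Proof.
by apply: (addrI (deruv 1)); rewrite addr0 -{3}[1]mulr1 deruvM mulr1 mul1r.
Qed.

Lemma deruvN (P : polyuv) : deruv (- P) = - deruv P.
Proof. by apply: (addrI (deruv P)); rewrite -deruvD !subrr deruv0. Qed.

Lemma deruv_u : deruv u = 1 - u.
Proof.
have -> : deruv u = 1 - (u + 0).
  rewrite deruv.unlock derivX mulr1; congr (_ - (_ + _)); apply/polyP => i.
  rewrite coef_map_id0 ?deriv0 ?mulr0 // coefX coef0.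
  by case: (i == 1)%N; rewrite ?derivC ?deriv0 mulr0.
by rewrite addr0.
Qed.

Lemma deruv_v : deruv v = - v.
Proof.
rewrite deruv.unlock derivC mulr0 !add0r; congr (- _); apply/polyP => i.
rewrite coef_map_id0 ?deriv0 ?mulr0 // coefC.
by case: (i == 0)%N; rewrite ?derivX ?mulr1 // deriv0 mulr0.
Qed.

Lemma deruvX (P : polyuv) n : deruv (P ^+ n) = n%:R * P ^+ n.-1 * deruv P.
Proof.
elim: n => [|n IH]; first by rewrite deruv1 !mul0r.
rewrite exprS deruvM IH /=; case: n {IH} => [|n] /=.
  by rewrite expr0; ring.
by rewrite (mulrS _ n.+1) exprS; ring.
Qed.

Lemma deruv_mulmx (A B : 'M[polyuv]_2) :
  map_mx deruv (A * B) = map_mx deruv A * B + A * map_mx deruv B.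
Proof.
apply/matrixP => i j; rewrite [RHS]mxE [LHS]mxE !mx2_mulE deruvD !deruvM !mxE.
by rewrite addrACA.
Qed.

Lemma map_mx2 (f : polyuv -> polyuv) (a b c e : polyuv) :
  map_mx f (mx2 a b c e) = mx2 (f a) (f b) (f c) (f e).
Proof. by apply/matrixP => i j; rewrite !mxE; do 2 case: ifP => _. Qed.

Lemma mx2B (a b c e a' b' c' e' : polyuv) :
  mx2 a b c e - mx2 a' b' c' e' = mx2 (a - a') (b - b') (c - c') (e - e').
Proof. by apply/matrixP => i j; rewrite !mxE; do 2 case: ifP => _. Qed.

(* [Cmx b] is affine in [(u, v)] and [deruv] points towards [(1, 0)]. *)
Definition Cmx10 (b : bool) : 'M[polyuv]_2 :=
  if b then mx2 1 0 0 1 else mx2 1 0 1 0.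

Lemma deruv_Cmx b : map_mx deruv (Cmx b) = Cmx10 b - Cmx b.
Proof.
(* Each derivative is put in the form target minus current value, the shape of the entries of
   [Cmx10 b - Cmx b]. *)
have [Du Dv] : deruv u = 1 - u /\ deruv v = 0 - v.
  by split; [exact: deruv_u|rewrite sub0r; exact: deruv_v].
have [D0 D1] : deruv 0 = 0 - 0 /\ deruv 1 = 1 - 1.
  by split; rewrite subrr; [exact: deruv0|exact: deruv1].
by case: b; rewrite map_mx2 mx2B; congr mx2; [exact: Du|exact: Dv|exact: D0
  |exact: D1|exact: D1|exact: D0|exact: Du|exact: Dv].
Qed.

Lemma deruv_Mmx (w : seq bool) :
  map_mx deruv (Mmx w) =
  \sum_(j < size w) Mmx (take j w)
     * (Cmx10 (nth false w j) - Cmx (nth false w j)) * Mmx (drop j.+1 w).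
Proof.
elim: w => [|b w IH].
  rewrite big_ord0; apply/matrixP => i j; rewrite !mxE Mmx_nil.
  by case: (i == j); rewrite ?deruv1 ?deruv0.
rewrite Mmx_cons deruv_mulmx deruv_Cmx IH big_ord_recl /= drop0 /Mmx big_nil.
rewrite mul1r mulr_sumr; congr (_ + _); apply: eq_bigr => j _.
by rewrite big_cons /= !mulrA.
Qed.

(** Leibniz over the letters; cyclicity of the trace brings the altered letter to the front, and
    each subtracted [Cmx] term restores the trace of the full word. *)
Lemma deruv_trace (w : seq bool) :
  deruv (\tr (Mmx w)) =
  \sum_(j < size w) (\tr (Cmx10 (nth false w j) * Mmx (behead (rot j w)))
                     - \tr (Mmx w)).
Proof.
transitivity (\tr (map_mx deruv (Mmx w))).
  by rewrite !mxtrace2 deruvD !mxE.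
rewrite deruv_Mmx raddf_sum; apply: eq_bigr => j _.
have rotE : rot j w = nth false w j :: behead (rot j w).
  by rewrite /rot (drop_nth false).
rewrite -[in RHS](trace_rot j w) {2}rotE Mmx_cons -raddfB -mulrBl.
have -> : behead (rot j w) = drop j.+1 w ++ take j w.
  by rewrite /rot (drop_nth false).
rewrite Mmx_cat [in RHS]mulrA -[in LHS]mulrA.
exact: mxtrace_mulC.
Qed.

(** * The local LYM inequality *)

Lemma Hpoly_sub_deruv_ge0 (w : seq bool) :
  nneg_coefuv (Hpoly w - deruv (Hpoly w)).
Proof.
set k := size w.
pose U (j : 'I_k) := behead (rot j w).
pose b (j : 'I_k) := nth false w j.
have rotE (j : 'I_k) : rot j w = b j :: U j.
  by rewrite /U /rot /b (drop_nth false).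
(* [Y j] plays the part of [Hpoly] once letter [j] is replaced by [Cmx10]: for a one the letter
   disappears, for a zero the trace becomes the sum of row 0 of [Mmx (U j)]. *)
pose Y j := if b j then Hpoly (U j) else emb true (U j).
suff -> : Hpoly w - deruv (Hpoly w) = \sum_(j < k) (Hpoly w - Y j).
  apply: (big_ind nneg_coefuv); first exact: nneg_coefuv0.
    exact: nneg_coefuvD.
  move=> j _; rewrite -(Hpoly_rot j) rotE /Y.
  case: (b j); first exact: Hpoly_cons1_ge.
  exact: Hpoly_cons0_ge_emb.
pose R := nb_ones w; pose Z := nb_zeros w.
have kE : k = (R + Z)%N by rewrite /k -(count_predC id).
have RE : R = (\sum_(j < k) b j)%N.
  rewrite /R /nb_ones -sumn_count sumnE big_map (big_nth false) big_mkord.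
  by [].
have dI : injective ( *%R (d : polyuv)).
  by apply: mulfI; apply: monic_neq0; apply: uv1_monic.
apply: dI.
have trE : \tr (Mmx w) = 1 + d * Hpoly w + u ^+ R * v ^+ Z.
  by rewrite -Hpoly_spec subrK.
have trYE j : \tr (Cmx10 (b j) * Mmx (U j)) =
    1 + d * Y j + (b j)%:R * u ^+ R.-1 * v ^+ Z.
  have : nb_ones (rot j w) = R by rewrite /nb_ones count_rot.
  have : nb_zeros (rot j w) = Z by rewrite /nb_zeros count_rot.
  rewrite rotE /nb_ones /nb_zeros /Y /=; case: (b j) => /= ZE RE'.
    have -> : \tr (mx2 1 0 0 1 * Mmx (U j)) = \tr (Mmx (U j)).
      by rewrite !mxtrace2 !mx2_mulE !mxE /=; ring.
    rewrite -[LHS](subrK (u ^+ nb_ones (U j) * v ^+ nb_zeros (U j))).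
    rewrite Hpoly_spec /nb_ones /nb_zeros -ZE -RE' add0n add1n /=.
    by rewrite -mulrA mul1r.
  rewrite mxtrace2 !mx2_mulE !mxE /= (Mmx_row0 (U j)); ring.
have powE (x : polyuv) n : n%:R * (x * x ^+ n.-1) = n%:R * x ^+ n.
  by case: n => [|n]; rewrite ?mul0r // exprS.
pose A := u ^+ R.-1 * v ^+ Z; pose B := u ^+ R * v ^+ Z.
have E : deruv (\tr (Mmx w)) =
    d * (\sum_(j < k) (Y j - Hpoly w)) + (R%:R * A - k%:R * B).
  rewrite deruv_trace -/k; transitivity
    (\sum_(j < k) (d * (Y j - Hpoly w) + ((b j)%:R * A - B))).
    apply: eq_bigr => j _; rewrite -/(U j) -/(b j) trYE trE /A /B; ring.
  rewrite big_split /= -mulr_sumr; congr (_ + _).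
  by rewrite sumrB -mulr_suml -natr_sum -RE sumr_const card_ord -(mulr_natl B).
(* Second computation of the same derivative, now from the trace identity. As [deruv d = - d], the
   factor [d] comes out, and the monomial part is the same as in [E]. *)
have E' : deruv (\tr (Mmx w)) =
    d * (deruv (Hpoly w) - Hpoly w) + (R%:R * A - k%:R * B).
  rewrite trE 2!deruvD deruv1 !deruvM !deruvX !deruvD deruvN deruv1.
  rewrite deruv_u deruv_v kE natrD /A /B.
  have := powE u R; have := powE v Z.
  move: (u ^+ R) (v ^+ Z) (u ^+ R.-1) (v ^+ Z.-1) => a c a' c' Ev Eu.
  ring: Eu Ev.
have := etrans (esym E) E' => /addIr E1.
have -> : Hpoly w - deruv (Hpoly w) = - (deruv (Hpoly w) - Hpoly w).
  by rewrite opprB.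
rewrite mulrN -E1 -mulrN -sumrN; congr (_ * _).
by apply: eq_bigr => j _; rewrite opprB.
Qed.

Lemma h_local_LYM (w : seq bool) p q :
  h w p.+1 q *+ p.+1 <= h w p q *+ (p + q).+1.
Proof.
have := Hpoly_sub_deruv_ge0 w p q; rewrite 2!coefB -/(coefuv _ _ _).
rewrite -/(coefuv (deruv _) _ _) coef_deruv -!/(h w _ _) opprB addrA.
by rewrite -mulrS subr_ge0.
Qed.

(** The local inequality at [(l - 1, l)] reads [l * h_(l,l) <= 2 * l * h_(l-1,l)], and [l]
    cancels. *)
Lemma Delta_ge0 (w : seq bool) l : (0 < l)%N -> 0 <= Delta w l.
Proof.
case: l => // l _; have := h_local_LYM w l l.+1.
have -> : (l + l.+1).+1 = (2 * l.+1)%N by lia.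
by rewrite mulrnA lerMn2r /= -mulr_natl /Delta subr_ge0.
Qed.

(** * Gaps and top coefficients *)

(** Linear variant of [zero_gaps], suited to induction: the last gap counts only the trailing zeros,
    and leading zeros belong to no gap. *)
Fixpoint gaps (w : seq bool) : seq nat :=
  if w is b :: w' then
    if b then find id w' :: gaps w' else gaps w'
  else [::].

Lemma gapsE (w : seq bool) :
  gaps w = [seq find id (drop i.+1 w) | i <- iota 0 (size w) & nth false w i].
Proof.
elim: w => //= b w ->.
by case: b => /=; rewrite -[1%N]/(1 + 0)%N iotaDl filter_map -map_comp ?drop0.
Qed.

(** A search that wraps around the end meets the initial one at once, so wrapping adds nothing to a
    gap. *)
Lemma zero_gaps_cons1 (w : seq bool) :
  zero_gaps (true :: w) = gaps (true :: w).
Proof.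
rewrite gapsE /zero_gaps; apply/eq_in_map => i; rewrite mem_filter mem_iota.
set s := true :: w => /andP[si /= ltis].
rewrite /rot (drop_nth false) //= find_cat; case: ifP => // /negbT noone.
rewrite (_ : find id (take i s) = 0)%N; last by case: (i).
by rewrite addn0 hasNfind.
Qed.

Lemma zero_gaps_rot1 (w : seq bool) :
  perm_eq (zero_gaps (rot 1 w)) (zero_gaps w).
Proof.
case: w => // b s; rewrite /zero_gaps size_rot [size (b :: s)]/=.
rewrite -{1}(addn1 (size s)) iotaD add0n filter_cat map_cat perm_catC.
rewrite -(add1n (size s)) iotaD add0n filter_cat map_cat.
have rot1E : rot 1 (b :: s) = s ++ [:: b] by rewrite /rot /= drop0 take0.
apply: perm_cat.
  rewrite /= rot1E nth_cat ltnn subnn /=; case: b {rot1E} => //=.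
  by rewrite rot_size_cat /= cats0.
rewrite [iota 1 _](iotaDl 1 0) filter_map -map_comp.
rewrite (@eq_in_filter _ _ (nth false s)) => [|i]; last first.
  by rewrite mem_iota rot1E nth_cat => /= ->.
rewrite (eq_filter (a2 := nth false s)) //.
set A := map _ _; set B := map _ _; suff -> : A = B by [].
apply/eq_in_map => i; rewrite mem_filter mem_iota /= => /andP[_ lti].
by rewrite [(1 + i)%N]addnC rotD // addn1 ltnW.
Qed.

Lemma zero_gaps_rot n (w : seq bool) :
  perm_eq (zero_gaps (rot n w)) (zero_gaps w).
Proof.
elim: n => [|n IH]; first by rewrite rot0.
have [ltnw|leqwn] := ltnP n (size w).
  by rewrite rotS //; apply: perm_trans (zero_gaps_rot1 _) IH.
by rewrite rot_oversize // ltnW.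
Qed.

Lemma size_gaps (w : seq bool) : size (gaps w) = nb_ones w.
Proof. by rewrite /nb_ones; elim: w => //= -[] w <-. Qed.

Lemma sumn_gaps (w : seq bool) :
  (find id w + sumn (gaps w))%N = nb_zeros w.
Proof. by rewrite /nb_zeros; elim: w => //= -[] w IH /=; lia. Qed.

Definition chain_poly (z : nat) : {poly int} := \sum_(j < z.+1) 'X^j.

Lemma chain_polyS z : chain_poly z.+1 = 1 + 'X * chain_poly z.
Proof.
rewrite /chain_poly big_ord_recl expr0; congr (_ + _); rewrite mulr_sumr.
by apply: eq_bigr => j _; rewrite exprS.
Qed.

Lemma coef_uvD (P Q : polyuv) i :
  (u * P + v * Q)`_i = (if i == 0%N then 0 else P`_i.-1) + 'X * Q`_i.
Proof. by rewrite coefD coefXM coefCM. Qed.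

(** A one combines the two entries of the column: [u] times the upper one supplies the constant term
    of a new chain factor, [v] times the lower one its other terms. The lower entry thus has to
    remember the leading run of zeros, which is not yet closed by a one. *)
Lemma coef_Mmx_col0 (w : seq bool) (R := nb_ones w)
    (G := \prod_(z <- gaps w) chain_poly z) :
  [/\ (Mmx w 0 0)`_R = G, forall i, (R < i)%N -> (Mmx w 0 0)`_i = 0,
      (Mmx w 1 0)`_R.+1 = (\sum_(j < find id w) 'X^j) * G
    & forall i, (R.+1 < i)%N -> (Mmx w 1 0)`_i = 0].
Proof.
rewrite {}/R {}/G /nb_ones; elim: w => [|b w [E0 F0 E1 F1]] /=.
  rewrite !Mmx_nil big_nil big_ord0 mul0r !coef1 !coef0.
  by split=> // i; rewrite ?coef1 ?coef0 //; case: i.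
rewrite !Mmx_cons0 !Mmx_cons1; case: b => /=; rewrite ?(add0n, add1n).
  rewrite big_cons big_ord0 mul0r; split.
  - rewrite coef_uvD /= E0 E1 mulrA -[X in X + _]mul1r -mulrDl.
    rewrite /chain_poly big_ord_recl expr0 mulr_sumr; congr ((_ + _) * _).
    by apply: eq_bigr => j _; rewrite -exprS.
  - by move=> [|i] // lti; rewrite coef_uvD /= F0 // F1 // mulr0 addr0.
  - exact: F1.
  - by move=> i lti; apply: F1; apply: ltnW.
split=> //.
  rewrite coef_uvD /= E0 E1 mulrA -[X in X + _]mul1r -mulrDl big_ord_recl expr0.
  by rewrite mulr_sumr; congr ((_ + _) * _); apply: eq_bigr => j _; rewrite exprS.
by move=> [|i] // lti; rewrite coef_uvD /= F0 // F1 // mulr0 addr0.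
Qed.

Lemma coef_Mmx_col1 (w : seq bool) (R := nb_ones w) :
  (forall i, (R <= i)%N -> (Mmx w 0 1)`_i = 0) /\
  (forall i, (R < i)%N -> (Mmx w 1 1)`_i = 0).
Proof.
rewrite {}/R /nb_ones; elim: w => [|b w [F0 F1]] /=.
  by rewrite !Mmx_nil; split=> i; rewrite ?coef0 // coef1; case: i.
rewrite !Mmx_cons0 !Mmx_cons1; case: b => /=; rewrite ?(add0n, add1n); split=> //.
- by move=> [|i] // lti; rewrite coef_uvD /= F0 // F1 // mulr0 addr0.
- by move=> i lti; apply: F1; apply: ltnW.
- by move=> [|i] // lti; rewrite coef_uvD /= F0 // F1 // mulr0 addr0.
Qed.

Lemma coef_Hpoly_cons1 (s : seq bool) (w := true :: s) :
  (forall i, (nb_ones w <= i)%N -> (Hpoly w)`_i = 0) /\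
  (Hpoly w)`_(nb_ones w).-1 =
    \prod_(z <- gaps w) chain_poly z - 'X^(nb_zeros w).
Proof.
have [E0 F0 _ _] := coef_Mmx_col0 w; have [_ F1] := coef_Mmx_col1 w.
(* The initial one leaves row 1 unchanged, so the degree bound is that of [s], which has one fewer
   one. *)
have F1' i : (nb_ones w <= i)%N -> (Mmx w 1 1)`_i = 0.
  have [_ F] := coef_Mmx_col1 s.
  by move=> lti; rewrite Mmx_cons1 F // -add1n.
set R := nb_ones w in E0 F0 F1 F1' *.
have R_gt0 : (0 < R)%N by [].
have vZE : v ^+ nb_zeros w = ('X^(nb_zeros w))%:P :> polyuv.
  by rewrite /vvar -polyC_exp.
have := Hpoly_spec w; rewrite -/R mxtrace2 vZE mulrC.
rewrite -[u + v - 1]addrA -[v - 1]opprK opprB.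
rewrite (_ : 1 - v = (1 - 'X)%:P) => [E|]; last by rewrite polyCB.
(* With [d = u - (1 - v)], comparing coefficients of [u^(i+1)] gives the quotient by descending
   recursion. *)
have HE i : (Hpoly w)`_i =
    (Mmx w 0 0)`_i.+1 + (Mmx w 1 1)`_i.+1
    - 'X^(nb_zeros w) * (i.+1 == R)%:R + (1 - 'X) * (Hpoly w)`_i.+1.
  have := congr1 (fun P : polyuv => P`_i.+1) E.
  rewrite coefB coefD coefCM coefXn => ->.
  rewrite coefD coef1 add0r mulrBl coefB coefXM coefCM /=; ring.
have H0 i : (R <= i)%N -> (Hpoly w)`_i = 0.
  have [m] := ubnP (size (Hpoly w) - i); elim: m i => // m IH i lem leRi.
  have [|lti] := leqP (size (Hpoly w)) i; first by move/leq_sizeP; apply.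
  rewrite HE F0 // F1' 1?ltnW // IH; [|lia|lia].
  by rewrite gtn_eqF // !(mulr0, addr0, subr0).
by split=> //; rewrite HE prednK // E0 F1' // H0 // eqxx mulr1 mulr0 !addr0.
Qed.

(** Reduces the cyclic statements below to words that start with a one. *)
Lemma rot_cons1 (w : seq bool) :
  (0 < nb_ones w)%N -> exists n s, rot n w = true :: s.
Proof.
by rewrite -has_count => /hasP[[] // /rot_to[n s E] _]; exists n, s.
Qed.

Lemma h_eq0 (w : seq bool) p q :
  (0 < nb_ones w)%N -> (nb_ones w <= p)%N -> h w p q = 0.
Proof.
move=> w1 lep; have [n [s E]] := rot_cons1 w1.
rewrite /h /coefuv -(Hpoly_rot n) E.
have [F _] := coef_Hpoly_cons1 s; rewrite F ?coef0 //.
by rewrite -E /nb_ones count_rot.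
Qed.

Lemma h_top (w : seq bool) q :
  (0 < nb_ones w)%N ->
  h w (nb_ones w).-1 q =
  (\prod_(z <- zero_gaps w) chain_poly z)`_q - (q == nb_zeros w)%:R.
Proof.
move=> w1; have [n [s E]] := rot_cons1 w1.
rewrite /h /coefuv -(Hpoly_rot n) -(perm_big _ (zero_gaps_rot n w)) /=.
rewrite /nb_ones /nb_zeros -!(count_rot _ n w) E zero_gaps_cons1.
have [_ ->] := coef_Hpoly_cons1 s.
by rewrite coefB coefXn.
Qed.

Lemma size_zero_gaps (w : seq bool) :
  (0 < nb_ones w)%N -> size (zero_gaps w) = nb_ones w.
Proof.
move=> w1; have [n [s E]] := rot_cons1 w1.
rewrite -(perm_size (zero_gaps_rot n w)) E zero_gaps_cons1 size_gaps -E.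
by rewrite /nb_ones count_rot.
Qed.

Lemma sumn_zero_gaps (w : seq bool) :
  (0 < nb_ones w)%N -> sumn (zero_gaps w) = nb_zeros w.
Proof.
move=> w1; have [n [s E]] := rot_cons1 w1.
rewrite -(perm_sumn (zero_gaps_rot n w)) E zero_gaps_cons1.
have := sumn_gaps (true :: s); rewrite -{3}E /nb_zeros count_rot => <-.
by rewrite add0n.
Qed.

(** * Products of chains *)

Lemma coef_chain_poly z i : (chain_poly z)`_i = (i <= z)%:R.
Proof.
rewrite /chain_poly coef_sum.
under eq_bigr do rewrite coefXn.
have [leiz|ltzi] := leqP i z.
  rewrite (bigD1 (Ordinal (leiz : i < z.+1)%N)) //= eqxx big1 ?addr0 // => j.
  by rewrite -val_eqE /= eq_sym => /negPf ->.
by rewrite big1 // => j _; rewrite gtn_eqF //; have := ltn_ord j; lia.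
Qed.

Lemma nneg_chain_poly z : nneg_coef (chain_poly z).
Proof. by move=> i; rewrite coef_chain_poly. Qed.

(** Two gaps [a + 1] and [b + 1] may be traded for gaps [1] and [a + b + 1], of the same total,
    without increasing any coefficient. In the induction on [a] the excess is multiplied by ['X] and
    gains [chain_poly b.+1 - (1 + 'X)]. *)
Lemma chain_polyM_ge a b :
  nneg_coef (chain_poly a.+1 * chain_poly b.+1
             - (1 + 'X) * chain_poly (a + b).+1).
Proof.
elim: a => [|a IH].
  rewrite add0n !(chain_polyS 0) {1}/chain_poly big_ord1 expr0 mulr1 subrr.
  exact: nneg_coef0.
have -> : chain_poly a.+2 * chain_poly b.+1 - (1 + 'X) * chain_poly (a.+1 + b).+1
  = 'X * (chain_poly a.+1 * chain_poly b.+1 - (1 + 'X) * chain_poly (a + b).+1)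
    + (chain_poly b.+1 - (1 + 'X)).
  by rewrite (chain_polyS a.+1) addSn (chain_polyS (a + b).+1); ring.
apply: nneg_coefD; first exact: nneg_coefM nneg_coefX IH.
move=> i; rewrite coefB coefD coef1 coefX coef_chain_poly.
by case: i => [|[|i]] //=; rewrite ?subr0 // ler0n.
Qed.

(** Iterates the trade: all gaps merge into one long chain, and each merge leaves a factor
    [1 + 'X]. *)
Lemma prod_chain_poly_ge (z : nat) (zs : seq nat) :
  nneg_coef (\prod_(y <- z :: zs) chain_poly y.+1
             - (1 + 'X) ^+ size zs * chain_poly (z + sumn zs).+1).
Proof.
elim: zs z => [|y zs IH] z.
  by rewrite big_seq1 expr0 mul1r addn0 subrr; apply: nneg_coef0.
have -> : \prod_(x <- [:: z, y & zs]) chain_poly x.+1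
    - (1 + 'X) ^+ size (y :: zs) * chain_poly (z + sumn (y :: zs)).+1
  = (chain_poly z.+1 * chain_poly y.+1 - (1 + 'X) * chain_poly (z + y).+1)
      * \prod_(x <- zs) chain_poly x.+1
    + (1 + 'X) * (\prod_(x <- (z + y)%N :: zs) chain_poly x.+1
                  - (1 + 'X) ^+ size zs * chain_poly (z + y + sumn zs).+1).
  rewrite !big_cons /= addnA exprS; ring.
apply: nneg_coefD; apply: nneg_coefM.
- exact: chain_polyM_ge.
- apply: (big_ind nneg_coef) => [|P Q|x _]; first exact: nneg_coef1.
    exact: nneg_coefM.
  exact: nneg_chain_poly.
- exact: nneg_coefD nneg_coef1 nneg_coefX.
- exact: IH.
Qed.

Lemma prod_chain_poly_pos (zs : seq nat) :
  \prod_(z <- zs) chain_poly z =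
  \prod_(y <- [seq z.-1 | z <- zs & (0 < z)%N]) chain_poly y.+1.
Proof.
rewrite big_map big_filter [RHS]big_mkcond; apply: eq_bigr => -[|z] _ //=.
by rewrite /chain_poly big_ord1 expr0.
Qed.

Lemma prod_chain_poly_coef_ge (zs : seq nat) (s := count (fun z => 0 < z)%N zs) m :
  (size zs <= m)%N -> (m < sumn zs)%N ->
  (\sum_(r < (minn (sumn zs - m) (s - 1)).+1) 'C(s - 1, r))%:Z <=
  (\prod_(z <- zs) chain_poly z)`_m.
Proof.
move=> lem ltm; rewrite prod_chain_poly_pos.
have les : (s <= size zs)%N by rewrite count_size.
set ys := [seq z.-1 | z <- zs & (0 < z)%N].
have szy : size ys = s by rewrite size_map size_filter.
have sumE : (sumn ys + s = sumn zs)%N.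
  by rewrite /ys /s; elim: (zs) => //= -[|z] l IH //=; lia.
clearbody ys; case: ys szy sumE => [|y ys] szy sumE.
  by move: sumE ltm; rewrite -szy /= => <-.
have := prod_chain_poly_ge y ys m; rewrite coefB subr_ge0; apply: le_trans.
have ysE : size ys = (s - 1)%N by rewrite -szy /= subn1.
have sumE' : (y + sumn ys + s = sumn zs)%N by rewrite -sumE.
rewrite ysE; set n := (s - 1)%N; set Y := (y + sumn ys)%N in sumE' *.
have sE : s = n.+1 by rewrite /n -szy /= subn1.
have lenm : (n < m)%N by rewrite -sE (leq_trans les).
rewrite addrC exprD1n mulr_suml coef_sum -[Posz _]natz natr_sum.
have lemin : (minn (sumn zs - m) n < n.+1)%N by rewrite ltnS geq_minr.
have /= -> := big_ord_widen n.+1 (fun r => 'C(n, r)%:R : int) lemin.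
(* The substitution of [n - r] for [r] preserves the binomial coefficient and turns the degree bound
   [m - (n - r) <= Y + 1] into [r <= sumn zs - m]; as [n < m], the exponent [m - (n - r)] is never
   truncated. *)
rewrite big_mkcond [X in _ <= X](reindex_inj rev_ord_inj) /=.
rewrite le_eqVlt; apply/orP; left; apply/eqP/eq_bigr => r _ /=.
rewrite subSS mulrnAl coefMn coefXnM coef_chain_poly.
have := ltn_ord r; rewrite ltnS => lern.
rewrite bin_sub // [(m < _)%N]ltnNge (leq_trans (leq_subr _ _) (ltnW lenm)) /=.
rewrite ltnS leq_min lern andbT.
rewrite (_ : (m - (n - r) <= Y.+1)%N = (r <= sumn zs - m)%N).
  by case: ifP; rewrite ?mul0rn // -[RHS]mulr_natr mul1r natz.
by apply/idP/idP; lia.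
Qed.

(** * Binary weights *)

Lemma bit_double (b : bool) n i :
  bit (b + n.*2) i = if i is j.+1 then bit n j else b.
Proof.
rewrite /bit; case: i => [|j].
  by rewrite expn0 divn1 oddD odd_double addbF; case: b.
rewrite expnS divnMA; congr (odd (_ %/ _)).
by rewrite -muln2 addnC divnMDl // divn_small ?addn0 //; case: b.
Qed.

Lemma wt_widen n m : (n < 2 ^ m)%N -> wt n = (\sum_(i < m) bit n i)%N.
Proof.
have bit0 i : (n < 2 ^ i)%N -> bit n i = false by rewrite /bit => /divn_small ->.
have E l1 l2 : (n < 2 ^ l1)%N -> (l1 <= l2)%N ->
    (\sum_(i < l1) bit n i = \sum_(i < l2) bit n i)%N.
  move=> lt1 le12; rewrite (big_ord_widen l2 (fun i => nat_of_bool (bit n i))) //.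
  rewrite big_mkcond; apply: eq_bigr => i _; case: ltnP => // le1i.
  by rewrite bit0 // (leq_trans lt1) // leq_exp2l.
move=> ltnm; rewrite /wt; case/orP: (leq_total n m) => [lenm|lemn].
  by apply: E => //; apply: ltn_expl.
by rewrite (E _ _ ltnm lemn).
Qed.

Lemma wt_double (b : bool) n : wt (b + n.*2) = (b + wt n)%N.
Proof.
have ltn2 : (n < 2 ^ n)%N by apply: ltn_expl.
rewrite (@wt_widen _ n.+1); last by rewrite expnS; case: b; lia.
rewrite big_ord_recl bit_double; congr (_ + _)%N.
by apply: eq_bigr => i _; rewrite bit_double.
Qed.

Lemma odd_halfE n : n = (odd n + n./2.*2)%N.
Proof. by rewrite odd_double_half. Qed.

(** Subtraction from [2 ^ k - 1] flips each of the [k] bits. *)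
Lemma wt_compl k a : (a < 2 ^ k)%N -> (wt (2 ^ k - 1 - a) + wt a = k)%N.
Proof.
elim: k a => [|k IH] a.
  by rewrite expn0 ltnS leqn0 => /eqP->; rewrite /wt big_ord0.
rewrite expnS => lta; have {}IH := IH a./2; rewrite [a in LHS]odd_halfE.
have -> : (2 * 2 ^ k - 1 - (odd a + a./2.*2) =
           ~~ odd a + (2 ^ k - 1 - a./2).*2)%N.
  by move: lta; rewrite {1}[a]odd_halfE; case: (odd a); lia.
rewrite !wt_double addnACA IH; last by lia.
by case: (odd a).
Qed.

Lemma bitwordS k t : bitword k.+1 t = odd t :: bitword k t./2.
Proof.
rewrite /bitword /mkseq /= [iota 1 k](iotaDl 1 0) -map_comp {1}[t]odd_halfE.
rewrite bit_double; congr (_ :: _); apply: eq_map => i /=.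
by rewrite {1}[t]odd_halfE bit_double.
Qed.

(** The first component of a pair determines the second. Replacing it by its complement [N - a]
    turns the condition on the sum of weights into a comparison of the weights before and after
    adding [t]. *)
Lemma card_Sset k t : (0 < k)%N ->
  #|Sset t k| =
  (\sum_(a < 2 ^ k) (wt ((a + t) %% (2 ^ k - 1)) < wt a))%N.
Proof.
move=> k_gt0; set N := (2 ^ k - 1)%N.
have two_k : (2 ^ k = N.+1)%N by rewrite /N subn1 prednK // expn_gt0.
have N_gt0 : (0 < N)%N.
  by rewrite -ltnS -two_k -[X in (X < _)%N](expn0 2) ltn_exp2l.
pose opp (a : 'I_N) : 'I_N := Ordinal (ltn_pmod (t + N - a) N_gt0).
have oppE (a b : 'I_N) : (a + b == t %[mod N])%N = (b == opp a).
  have lea : (a <= t + N)%N by rewrite ltnW // ltn_addl.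
  rewrite -(eqn_modDr (N - a)) -addnA (addnC b) addnA (addnC a).
  rewrite subnK ?(ltnW (ltn_ord a)) // modnDl addnBA ?(ltnW (ltn_ord a)) //.
  by rewrite modn_small // -val_eqE.
pose A := [set a : 'I_N | (wt a + wt (opp a) < k)%N].
have -> : Sset t k = [set (a, opp a) | a in A].
  apply/setP=> -[a b]; rewrite inE /= oppE; apply/andP/imsetP.
    by move=> [/eqP-> lt]; exists a; rewrite ?inE.
  by move=> [a']; rewrite inE => lt [-> ->]; rewrite eqxx.
rewrite card_imset => [|a b []//]; rewrite -sum1_card big_mkcond /=.
(* The index 0 contributes nothing, since no weight is below [wt 0 = 0]; the others are the
   complements of [0, ..., N - 1]. *)
have -> : (\sum_(a < 2 ^ k) (wt ((a + t) %% N) < wt a) =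
           \sum_(a < N) (wt ((a.+1 + t) %% N) < wt a.+1))%N.
  by rewrite two_k big_ord_recl [wt 0]big_ord0.
rewrite [RHS](reindex_inj rev_ord_inj) /=; apply: eq_bigr => a _.
rewrite inE subnSK // /opp /=.
have := @wt_compl k a; rewrite two_k ltnS => /(_ (ltnW (ltn_ord a))).
rewrite -two_k -/N addnC addnBAC ?(ltnW (ltn_ord a)) // (addnC N) => <-.
by rewrite ltn_add2l; case: ltnP.
Qed.

(** * Evaluation at one half *)

Section LinearFunctional.
Variable A : nzRingType.
Implicit Types (f : nat -> A -> rat) (P Q : {poly A}).

(** Functional prescribed coefficient by coefficient; it is nested to cover both levels of
    [{poly {poly int}}]. *)
Definition plin f P : rat := \sum_(i < size P) f i P`_i.

Variable f : nat -> A -> rat.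
Hypothesis f0 : forall i, f i 0 = 0.
Hypothesis fD : forall i a b, f i (a + b) = f i a + f i b.

Lemma plin_widen n P : (size P <= n)%N -> plin f P = \sum_(i < n) f i P`_i.
Proof.
move=> le; rewrite /plin (big_ord_widen n (fun i => f i P`_i)) // big_mkcond.
by apply: eq_bigr => i _; case: ltnP => // le'; rewrite nth_default // f0.
Qed.

Lemma plinD P Q : plin f (P + Q) = plin f P + plin f Q.
Proof.
set n := maxn (size P) (size Q).
rewrite (@plin_widen n) ?size_polyD // (@plin_widen n P) ?leq_maxl //.
rewrite (@plin_widen n Q) ?leq_maxr // -big_split /=.
by apply: eq_bigr => i _; rewrite coefD fD.
Qed.

Lemma plinXM P : plin f ('X * P) = plin (fun i => f i.+1) P.
Proof.
rewrite -commr_polyX (@plin_widen (size P).+1) => [|]; last first.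
  by apply: leq_trans (size_polyMleq _ _) _; rewrite size_polyX addn2.
rewrite big_ord_recl coefMX f0 add0r; apply: eq_bigr => i _.
by rewrite coefMX.
Qed.

Lemma plinC a : plin f a%:P = f 0%N a.
Proof.
rewrite (@plin_widen 1) ?size_polyC ?leq_b1 // big_ord1.
by rewrite coefC.
Qed.

Lemma plinCM a P : plin f (a%:P * P) = plin (fun i c => f i (a * c)) P.
Proof.
rewrite (@plin_widen (size P)); last by rewrite mul_polyC size_scale_leq.
by apply: eq_bigr => i _; rewrite coefCM.
Qed.

End LinearFunctional.

Lemma eq_plin (A : nzRingType) (f f' : nat -> A -> rat) P :
  (forall i a, f i a = f' i a) -> plin f P = plin f' P.
Proof. by move=> E; apply: eq_bigr => i _. Qed.

Lemma plinZ (A : nzRingType) (f : nat -> A -> rat) (c : rat) P :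
  plin (fun i a => c * f i a) P = c * plin f P.
Proof. by rewrite /plin mulr_sumr. Qed.

(* [half_eval g] is [u := 1/(2x)], [v := x/2] followed by [x^z := g z]. *)
Definition half_eval (g : int -> rat) (P : polyuv) : rat :=
  plin (fun p c =>
    plin (fun q (n : int) => g (q%:Z - p%:Z) * n%:~R / 2 ^+ (p + q)) c) P.

Section HalfEval.
Implicit Types (g : int -> rat) (P Q : polyuv).

Let wgt0 g p q : g (q%:Z - p%:Z) * (0 : int)%:~R / 2 ^+ (p + q) = 0 :> rat.
Proof. by rewrite mulr0 mul0r. Qed.

Let wgtD g p q (a b : int) :
  g (q%:Z - p%:Z) * (a + b)%:~R / 2 ^+ (p + q) =
  g (q%:Z - p%:Z) * a%:~R / 2 ^+ (p + q)
  + g (q%:Z - p%:Z) * b%:~R / 2 ^+ (p + q) :> rat.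
Proof. by rewrite intrD mulrDr mulrDl. Qed.

Let row0 g p :
  plin (fun q (n : int) => g (q%:Z - p%:Z) * n%:~R / 2 ^+ (p + q) : rat) 0 = 0.
Proof. by rewrite /plin size_poly0 big_ord0. Qed.

Lemma half_evalD g P Q :
  half_eval g (P + Q) = half_eval g P + half_eval g Q.
Proof. by apply: plinD => // p a b; apply: plinD. Qed.

Lemma half_eval0 g : half_eval g 0 = 0.
Proof. by rewrite /half_eval /plin size_poly0 big_ord0. Qed.

Lemma half_evalN g P : half_eval g (- P) = - half_eval g P.
Proof.
by apply: (addrI (half_eval g P)); rewrite -half_evalD !subrr half_eval0.
Qed.

Lemma eq_half_eval g g' P : g =1 g' -> half_eval g P = half_eval g' P.
Proof.
by move=> E; apply: eq_plin => p c; apply: eq_plin => q n; rewrite E.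
Qed.

Lemma half_evalMu g P :
  half_eval g (u * P) = half_eval (fun z => g (z - 1)) P / 2.
Proof.
rewrite /half_eval plinXM // mulrC -plinZ.
apply: eq_plin => p c; rewrite -plinZ; apply: eq_plin => q n.
rewrite addSn exprS invfM -[p.+1]addn1 PoszD opprD addrA; ring.
Qed.

Lemma half_evalMv g P :
  half_eval g (v * P) = half_eval (fun z => g (z + 1)) P / 2.
Proof.
rewrite /half_eval plinCM // mulrC -plinZ.
apply: eq_plin => p c; rewrite plinXM // -plinZ; apply: eq_plin => q n.
rewrite addnS exprS invfM -[q.+1]addn1 PoszD addrAC; ring.
Qed.

Lemma half_eval1 g : half_eval g 1 = g 0.
Proof.
by rewrite /half_eval -polyC1 plinC // -polyC1 plinC // expr0 divr1 mulr1.
Qed.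

End HalfEval.

(* Adding [t] and an incoming carry [c0] to a uniform [k]-bit number [a]:
   [carry_sum k t c0 c1 g] sums [g], evaluated at the drop of the weight, over
   the [a] with outgoing carry [c1]. *)
Definition carry_sum (k t : nat) (c0 c1 : bool) (g : int -> rat) : rat :=
  \sum_(a < 2 ^ k) if (((a + t + c0) %/ 2 ^ k)%N == c1)
                   then g ((wt a)%:Z - (wt ((a + t + c0) %% 2 ^ k))%:Z) else 0.

Lemma sum_double (n : nat) (F : nat -> rat) :
  \sum_(a < n.*2) F a = \sum_(a < n) (F (false + a.*2)%N + F (true + a.*2)%N).
Proof.
by elim: n => [|n IH]; rewrite ?big_ord0 // doubleS !big_ord_recr /= IH addrA.
Qed.

Lemma sum_exp2S (k : nat) (F : nat -> rat) :
  \sum_(a < 2 ^ k.+1) F a =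
  \sum_(a < 2 ^ k) (F (false + a.*2)%N + F (true + a.*2)%N).
Proof. by rewrite expnS mul2n sum_double. Qed.

(** Lowest column of the addition: [a0], [odd t] and [c0] produce the digit [b0] and the carry [c'],
    the weight drop changes by [a0 - b0], and the higher columns form the same problem for
    [t./2]. *)
Lemma carry_sum_digit k t (c0 c1 a0 b0 c' : bool) g :
  (a0 + odd t + c0 = b0 + c'.*2)%N ->
  \sum_(a < 2 ^ k)
    (if (((a0 + a.*2 + t + c0) %/ 2 ^ k.+1)%N == c1)
     then g ((wt (a0 + a.*2))%:Z - (wt ((a0 + a.*2 + t + c0) %% 2 ^ k.+1))%:Z)
     else 0) =
  carry_sum k t./2 c' c1 (fun z => g (z + a0%:Z - b0%:Z)).
Proof.
move=> E; apply: eq_bigr => a _; set m := (a + t./2 + c')%N.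
have -> : (a0 + a.*2 + t + c0 = b0 + m.*2)%N.
  by rewrite {1}[t]odd_halfE /m; lia.
have b0_lt : (b0 < 2)%N by case: (b0).
have -> : ((b0 + m.*2) %/ 2 ^ k.+1 = m %/ 2 ^ k)%N.
  by rewrite expnS divnMA -muln2 addnC divnMDl // (divn_small b0_lt) addn0.
have -> : ((b0 + m.*2) %% 2 ^ k.+1 = b0 + (m %% 2 ^ k).*2)%N.
  have -> : (b0 + m.*2 = m %/ 2 ^ k * 2 ^ k.+1 + (b0 + (m %% 2 ^ k).*2))%N.
    by rewrite {1}(divn_eq m (2 ^ k)) expnS; lia.
  rewrite modnMDl modn_small // expnS.
  have := @ltn_pmod m (2 ^ k); rewrite expn_gt0 => /(_ isT); lia.
by rewrite !wt_double !PoszD; congr (if _ then g _ else _); ring.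
Qed.

(** [Cmx] is the transfer matrix of one column, index 1 meaning a carry: [u] marks a digit 0 of [a]
    becoming 1, [v] a digit 1 becoming 0. The factor 2 per letter offsets the halves in
    [half_eval]. *)
Lemma carry_sumE k t c0 c1 g : (t < 2 ^ k)%N ->
  carry_sum k t c0 c1 g =
  2 ^+ k * half_eval g (Mmx (bitword k t) (inord c0) (inord c1)).
Proof.
have I0 : inord false = 0 :> 'I_2 by apply/val_inj; rewrite /= inordK.
have I1 : inord true = 1 :> 'I_2 by apply/val_inj; rewrite /= inordK.
elim: k t c0 g => [|k IH] t c0 g.
  rewrite expn0 ltnS leqn0 => /eqP->; rewrite /carry_sum big_ord1 /= Mmx_nil.
  rewrite divn1 modn1 subrr mul1r.
  by case: c0 c1 => -[]; rewrite ?I0 ?I1 ?half_eval1 ?half_eval0.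
move=> lt; rewrite bitwordS.
have {}lt : (t./2 < 2 ^ k)%N by move: lt; rewrite expnS {1}[t]odd_halfE; lia.
transitivity (\sum_(a0 : bool) \sum_(a < 2 ^ k)
    (if (((a0 + a.*2 + t + c0) %/ 2 ^ k.+1)%N == c1)
     then g ((wt (a0 + a.*2))%:Z - (wt ((a0 + a.*2 + t + c0) %% 2 ^ k.+1))%:Z)
     else 0)).
  apply: etrans (sum_exp2S _ (fun a => if ((a + t + c0) %/ 2 ^ k.+1)%N == c1
    then g ((wt a)%:Z - (wt ((a + t + c0) %% 2 ^ k.+1))%:Z) else 0)) _.
  by rewrite big_split big_bool /= addrC.
have step (a0 b0 c' : bool) : (a0 + odd t + c0 = b0 + c'.*2)%N ->
    \sum_(a < 2 ^ k)
    (if (((a0 + a.*2 + t + c0) %/ 2 ^ k.+1)%N == c1)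
     then g ((wt (a0 + a.*2))%:Z - (wt ((a0 + a.*2 + t + c0) %% 2 ^ k.+1))%:Z)
     else 0) =
    2 ^+ k * half_eval (fun z => g (z + a0%:Z - b0%:Z))
               (Mmx (bitword k t./2) (inord c') (inord c1)).
  by move=> E; rewrite (carry_sum_digit _ _ _ E) IH.
have gid (b : bool) P :
    half_eval (fun z => g (z + b%:Z - b%:Z)) P = half_eval g P.
  by apply: eq_half_eval => z; rewrite addrK.
have gu P : half_eval (fun z => g (z + false%:Z - true%:Z)) P =
    2 * half_eval g (u * P).
  by rewrite half_evalMu mulrC divfK //; apply: eq_half_eval => z; rewrite addr0.
have gv P : half_eval (fun z => g (z + true%:Z - false%:Z)) P =
    2 * half_eval g (v * P).
  by rewrite half_evalMv mulrC divfK //; apply: eq_half_eval => z; rewrite subr0.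
(* If [odd t = c0], the carry persists and the digit of [a] is kept, for both digits; otherwise the
   digit is flipped and the new carry is the old digit. *)
rewrite big_bool exprS /=; case: (odd t) c0 step => -[] step.
- rewrite (step true true true) // (step false false true) // !gid I1 Mmx_cons1.
  by ring.
- rewrite (step true false true) // (step false true false) // I0 I1 gu gv.
  by rewrite Mmx_cons0 half_evalD; ring.
- rewrite (step true false true) // (step false true false) // I0 I1 gu gv.
  by rewrite Mmx_cons1 half_evalD; ring.
rewrite (step true true false) // (step false false false) // !gid I0 Mmx_cons0.
by ring.
Qed.

Lemma half_eval_lin a b g g' (P : polyuv) :
  half_eval (fun z => a * g z + b * g' z) P =
  a * half_eval g P + b * half_eval g' P.
Proof.
rewrite /half_eval /plin !mulr_sumr -big_split; apply: eq_bigr => p _ /=.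
rewrite !mulr_sumr -big_split; apply: eq_bigr => q _ /=; ring.
Qed.

Lemma half_evalMd g (P : polyuv) :
  half_eval g (d * P) =
  half_eval (fun z => (g (z - 1) + g (z + 1)) / 2 - g z) P.
Proof.
have -> : d * P = u * P + v * P + - P by ring.
rewrite !half_evalD half_evalN half_evalMu half_evalMv -mulrDl.
rewrite [RHS](@eq_half_eval _ (fun z =>
  2^-1 * (1 * g (z - 1) + 1 * g (z + 1)) + (-1) * g z)) => [|z]; last first.
  by rewrite /=; field.
rewrite half_eval_lin -[half_eval g P in RHS]mul1r.
by rewrite (half_eval_lin 1 1 (fun z => g (z - 1))); field.
Qed.

Lemma half_eval_monomial g m n :
  half_eval g (u ^+ m * v ^+ n) = g (n%:Z - m%:Z) / 2 ^+ (m + n).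
Proof.
elim: m g => [|m IH] g.
  rewrite mul1r add0n subr0; elim: n g => [|n IH] g.
    by rewrite half_eval1 divr1.
  by rewrite !exprS half_evalMv IH invfM [n.+1%:Z]intS [1 + _]addrC; ring.
rewrite exprS -mulrA half_evalMu IH addSn exprS invfM [m.+1%:Z]intS opprD.
by rewrite [- 1 + _]addrC addrA; ring.
Qed.

(** The monomials giving [x^j] are those with [q = p + j]; only [j = 0] and [j = 1] will occur. *)
Lemma half_eval_diag j n (P : polyuv) : (size P <= n)%N ->
  half_eval (fun z => (z == j%:Z)%:R) P =
  \sum_(p < n) (coefuv P p (p + j))%:~R / 2 ^+ (p + (p + j)).
Proof.
move=> le; rewrite /half_eval (@plin_widen _ _ _ n) // => [|p]; last first.
  by rewrite /plin size_poly0 big_ord0.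
apply: eq_bigr => p _; rewrite /plin /coefuv.
have E q : (q%:Z - p%:Z == j%:Z) = (q == p + j)%N.
  by rewrite subr_eq -PoszD addnC.
under eq_bigr do rewrite E.
have [lt|le'] := ltnP (p + j) (size P`_p).
  rewrite (bigD1 (Ordinal lt)) //= eqxx mul1r big1 ?addr0 // => q.
  by rewrite -val_eqE => /negPf /= ->; rewrite !mul0r.
rewrite (nth_default _ le') mulr0z mul0r big1 // => q _.
by rewrite ltn_eqF ?mul0r // (leq_trans (ltn_ord q)).
Qed.

Definition posr (z : int) : rat := (0 < z)%R%:R.

(** The trace forces the outgoing carry to equal the incoming one: this end-around carry is addition
    modulo [2 ^ k - 1]. *)
Lemma card_Sset_half_eval k t : (0 < k)%N -> (0 < t)%N -> (t < 2 ^ k - 1)%N ->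
  #|Sset t k|%:R = 2 ^+ k * half_eval posr (\tr (Mmx (bitword k t))).
Proof.
move=> k_gt0 t_gt0 lt; have ltk : (t < 2 ^ k)%N by lia.
have I0 : inord false = 0 :> 'I_2 by apply/val_inj; rewrite /= inordK.
have I1 : inord true = 1 :> 'I_2 by apply/val_inj; rewrite /= inordK.
rewrite mxtrace2 half_evalD mulrDr -I0 -I1 -!carry_sumE // -big_split /=.
rewrite card_Sset // natr_sum; apply: eq_bigr => -[a /= lta] _.
have posE m n : posr (m%:Z - n%:Z) = (n < m)%N%:R.
  by rewrite /posr subr_gt0 ltz_nat.
rewrite !posE addn0 !eqn_leq.
set N := (2 ^ k - 1)%N in lt *.
have two_k : (2 ^ k = N.+1)%N by rewrite /N; lia.
rewrite two_k in lta ltk *.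
(* Below [N] only carry 0 reproduces itself, above [N] only carry 1. At [a + t = N] both do, but
   carry 0 yields the sum [N], whose full weight excludes a positive drop. *)
have [lt1|] := ltnP (a + t) N.
  rewrite !divn_small ?modn_small ?addn1 //; [|lia..].
  by rewrite addr0.
rewrite leq_eqVlt => /orP[/eqP aE|lt2].
  rewrite -aE addn1 divnn !modnn divn_small ?modn_small //=.
  have -> : wt 0 = 0%N by rewrite /wt big_ord0.
  suff /negPf -> : ~~ (wt N < wt a)%N by rewrite add0r.
  have := @wt_compl k 0; have := @wt_compl k a; rewrite two_k subn0 /= subn1 /=.
  by move=> /(_ lta) <- /(_ isT); rewrite /wt big_ord0 addn0 => ->; lia.
have lt3 : (a + t - N < N)%N by lia.
have -> : ((a + t) %/ N.+1 = 1)%N.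
  have -> : (a + t = 1 * N.+1 + (a + t - N.+1))%N by lia.
  by rewrite divnMDl // divn_small //; lia.
have -> : (a + t + 1 = 1 * N.+1 + (a + t - N))%N by lia.
have -> : ((a + t) %% N = a + t - N)%N.
  by rewrite -[in LHS](subnKC (ltnW lt2)) modnDl modn_small.
by rewrite divnMDl // modnMDl (divn_small (leqW lt3)) (modn_small (leqW lt3)) /= add0r.
Qed.

(** * Summation over the positive powers *)

(** At [u = v = 0] a letter of each kind kills both diagonal entries, so the trace identity becomes
    [0 = 1 - h w 0 0]. *)
Lemma h00 (w : seq bool) :
  (0 < nb_ones w)%N -> (0 < nb_zeros w)%N -> h w 0 0 = 1.
Proof.
move=> w1 w0.
have E (s : seq bool) : [/\ coefuv (Mmx s 0 0) 0 0 = (nb_ones s == 0%N)%:R,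
    coefuv (Mmx s 0 1) 0 0 = 0, coefuv (Mmx s 1 0) 0 0 = 0
    & coefuv (Mmx s 1 1) 0 0 = (nb_zeros s == 0%N)%:R].
  rewrite /coefuv /nb_ones /nb_zeros.
  elim: s => [|b s [E00 E01 E10 E11]]; first by rewrite !Mmx_nil !coef1 !coef0.
  by rewrite !Mmx_cons0 !Mmx_cons1; case: b; rewrite /= !coef_uvD /= !coefD
    !coef0 !coefXM /= ?addr0.
have := congr1 (fun P => coefuv P 0 0) (Hpoly_spec w).
have [E00 _ _ E11] := E w; move: E00 E11; rewrite /h /coefuv.
rewrite mxtrace2 !(coefB, coefD) => -> ->.
rewrite !gtn_eqF // -(prednK w1) exprS -mulrA coefXM /= coef0 addr0 subr0.
rewrite !coef1 /= [d * _]mulrBl mulrDl !(coefB, coefD) coefXM coefCM coefXM.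
by rewrite /= coef0 !add0r mul1r => /eqP; rewrite eq_sym subr_eq0 => /eqP.
Qed.

Lemma sum_Delta (w : seq bool) (R := nb_ones w) (Z := nb_zeros w) :
  (0 < R)%N -> (R < Z)%N ->
  2 ^+ (R + Z) * half_eval posr (\tr (Mmx w)) =
  1 + 2 ^+ (R + Z - 1) - 2 ^+ (Z - R) * (Mminus w)%:~R.
Proof.
move=> R_gt0 ltRZ.
have szH : (size (Hpoly w) <= R)%N.
  apply/leq_sizeP => p le; apply/polyP => q; rewrite coef0.
  exact: h_eq0.
have -> : \tr (Mmx w) = 1 + d * Hpoly w + u ^+ R * v ^+ Z.
  by rewrite -Hpoly_spec subrK.
rewrite !half_evalD half_eval1 half_evalMd half_eval_monomial.
have -> : posr 0 = 0 by [].
have -> : posr (Z%:Z - R%:Z) = 1 by rewrite /posr subr_gt0 ltz_nat ltRZ.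
(* Half the second difference of the indicator of positive integers is [1/2] at 0, [-1/2] at 1 and 0
   elsewhere. *)
rewrite (@eq_half_eval _ (fun z =>
  2^-1 * (z == 0%N%:Z)%:R + (- 2^-1) * (z == 1%N%:Z)%:R)); last first.
  move=> z; rewrite /posr.
  have -> : (0 < z + 1) = (0 < z) || (z == 0) by lia.
  have : ~~ ((0 < z) && (z == 0)) by lia.
  have -> : (0 < z) = (0 < z - 1) || (z == 1) by lia.
  have : ~~ ((0 < z - 1) && (z == 1)) by lia.
  by case: (0 < z - 1) (z == 1) (z == 0) => -[] [] //= _ _; field.
rewrite half_eval_lin !(@half_eval_diag _ R) //.
pose f l : rat := (Delta w l)%:~R / 4 ^+ l.
have E4 l : (2 : rat) ^+ (l + l) = 4 ^+ l.
  by rewrite addnn -mul2n exprM.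
(* Expressing [h_(l,l)] through [Delta] makes the two diagonal sums cancel term by term, up to the
   [f l], the initial [h w 0 0 = 1] and the unpaired last term [l = R]. *)
have hE l : (h w l.+1 l.+1)%:~R / 4 ^+ l.+1 =
    2 * (h w l l.+1)%:~R / 4 ^+ l.+1 - f l.+1 :> rat.
  by rewrite /f /Delta /= rmorphB rmorphM /=; ring.
have Ediag : \sum_(p < R) (coefuv (Hpoly w) p (p + 0))%:~R / 2 ^+ (p + (p + 0))
    = 1 + \sum_(1 <= l < R) (2 * (h w l.-1 l)%:~R / 4 ^+ l - f l) :> rat.
  rewrite -(prednK R_gt0) big_ord_recl -[coefuv _ ord0 _]/(h w 0 0).
  rewrite h00 ?divr1 ?(leq_trans _ ltRZ) //.
  rewrite big_add1 big_mkord; congr (_ + _); apply: eq_bigr => l _.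
  by rewrite !addn0 E4 -hE.
have Eoff : \sum_(p < R) (coefuv (Hpoly w) p (p + 1))%:~R / 2 ^+ (p + (p + 1))
    = \sum_(1 <= l < R) (2 * (h w l.-1 l)%:~R / 4 ^+ l)
      + 2 * (h w R.-1 R)%:~R / 4 ^+ R :> rat.
  transitivity (\sum_(1 <= l < R.+1) (2 * (h w l.-1 l)%:~R / 4 ^+ l) : rat).
    rewrite big_add1 big_mkord; apply: eq_bigr => l _ /=.
    by rewrite -E4 addn1 addSn exprS -mulf_div divff // mul1r.
  by rewrite big_nat_recr.
rewrite Ediag Eoff sumrB /Mminus -/R rmorphD rmorphM /= rmorph_sum /=.
have E2 : (2 : rat) ^+ (R + Z) = 2 ^+ (Z - R) * 4 ^+ R.
  by rewrite -E4 -exprD; congr (_ ^+ _); lia.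
have E2' : (2 : rat) ^+ (R + Z - 1) = 2 ^+ (R + Z) / 2.
  by rewrite -[in RHS](@subnK 1 (R + Z)) ?addn1 ?exprS; [field|lia].
have -> : \sum_(1 <= l < R) (4 ^+ (R - l - 1) * Delta w l)%:~R =
    4 ^+ R / 4 * \sum_(1 <= l < R) f l :> rat.
  rewrite mulr_sumr; apply: eq_big_nat => l /andP[_ ltlR].
  have {2}-> : R = (R - l - 1 + l + 1)%N by lia.
  rewrite !exprD /f rmorphM rmorphXn /=; field.
  by rewrite expf_neq0.
rewrite E2' E2; field.
by rewrite !expf_neq0.
Qed.

Lemma nb_ones_bitword_gt0 k t :
  (0 < t)%N -> (t < 2 ^ k)%N -> (0 < nb_ones (bitword k t))%N.
Proof.
elim: k t => [|k IH] t t_gt0; first by case: t t_gt0.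
rewrite expnS bitwordS /nb_ones /= => lt.
have := IH t./2; rewrite -/(nb_ones _).
by move: t_gt0 lt; rewrite {1 2}[t]odd_halfE; case: (odd t) => //=; lia.
Qed.

Theorem theorem7p9 (k t : nat) :
  (2 <= k)%N -> (1 <= t)%N -> (t < 2 ^ k - 1)%N ->
  let W := bitword k t in
  let R := nb_ones W in
  let Z := nb_zeros W in
  let s := nb_pos_gaps W in
  (R < Z)%N ->
  [/\ (* (i) *)
      [/\ 0 < Mminus W,
          2 ^+ (k - 1) - #|Sset t k|%:Z = 2 ^+ (Z - R) * Mminus W - 1
        & (#|Sset t k| = 1 %[mod 2 ^ (Z - R)])%N],
      (* (ii) *)
      Delta W R =
        2 * (\prod_(z <- zero_gaps W) \sum_(j < z.+1) 'X^j : {poly int})`_R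
    & (* (iii) *)
      2 ^+ (k - 1) - #|Sset t k|%:Z >=
        2 ^+ (Z - R)
          * (\sum_(r < (minn (Z - R) (s - 1)).+1) 'C(s - 1, r))%:Z - 1].
Proof.
move=> k_ge2 t_gt0 ltt W R Z s ltRZ.
have ltk : (t < 2 ^ k)%N by lia.
have kE : k = (R + Z)%N by rewrite -[LHS](size_mkseq (bit t)) -(count_predC id).
have R_gt0 : (0 < R)%N.
  exact: nb_ones_bitword_gt0.
(* The correction in [h_top] sits at [q = Z] and is absent here because [R < Z]. *)
have top : h W R.-1 R = (\prod_(z <- zero_gaps W) chain_poly z)`_R.
  by rewrite h_top // ltn_eqF ?subr0.
have cardE : 2 ^+ (k - 1) - #|Sset t k|%:Z = 2 ^+ (Z - R) * Mminus W - 1.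
  apply: (@intr_inj rat); rewrite !rmorphB rmorphM !rmorphXn /=.
  have := card_Sset_half_eval (ltnW k_ge2) t_gt0 ltt.
  rewrite [in 2 ^+ k]kE sum_Delta // -kE -pmulrn => ->; ring.
(* The [Delta] terms are nonnegative and are dropped; the remaining [h_(R-1,R)] is a coefficient of
   the product of chains. *)
have M_ge : (\sum_(r < (minn (Z - R) (s - 1)).+1) 'C(s - 1, r))%:Z <= Mminus W.
  rewrite /Mminus -/R top; apply: ler_wpDr.
    apply: mulr_ge0 => //; rewrite big_nat_cond; apply: sumr_ge0 => l.
    by rewrite andbT => /andP[l_gt0 _]; rewrite mulr_ge0 ?exprn_ge0 ?Delta_ge0.
  have <- : sumn (zero_gaps W) = Z by exact: sumn_zero_gaps.
  by apply: prod_chain_poly_coef_ge; rewrite ?size_zero_gaps ?sumn_zero_gaps.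
split.
- split=> //.
    apply: lt_le_trans M_ge; rewrite ltz_nat big_ord_recl bin0 //.
  have M_ge0 : 0 <= Mminus W by apply: le_trans M_ge.
  (* Additive form in [nat], free of truncated subtraction; the power [2 ^ (k - 1)] then vanishes
     modulo [2 ^ (Z - R)] because [R >= 1]. *)
  have Ecard : (`|Mminus W| * 2 ^ (Z - R) + #|Sset t k| = 2 ^ (k - 1) + 1)%N.
    apply/eqP; rewrite -eqz_nat !PoszD PoszM gez0_abs //.
    rewrite -![Posz (2 ^ _)]natz !natrX.
    by rewrite -(subrK #|Sset t k|%:Z (2 ^+ (k - 1))) cardE; apply/eqP; ring.
  rewrite -(modnMDl `|Mminus W|) Ecard.
  have -> : (k - 1 = (k - 1 - (Z - R)) + (Z - R))%N by lia.
  by rewrite expnD modnMDl.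
(* The degree of [Hpoly W] in [u] is below [R], so [h_(R,R) = 0]. *)
- by rewrite /Delta (h_eq0 R R_gt0 (leqnn R)) subr0 top.
by rewrite cardE lerD2r ler_wpM2l // exprn_ge0.
Qed.
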